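(* Let $\|\cdot\|$ be a norm on $\mathbb{R}^n$ with unit ball $\mathrm{B}=\{x:\|x\|\le 1\}$, let $K\subset\mathbb{R}^n$ be a convex body, and let $1\le i\le n$ with $\mathrm{r}_i(K,\mathrm{B})>0$. Then \[ \frac{\mathrm{R}_{n-i+1}(K,\mathrm{B})}{\mathrm{r}_i(K,\mathrm{B})}\leq n\sqrt{n}. \] If $\mathrm{B}$ is the Euclidean unit ball $\mathrm{B}_2$, or if $K$ is symmetric about the origin, the bound $n\sqrt n$ can be replaced by $n$. If both conditions hold, it can be replaced by $\sqrt{n}$.
   Context: A convex body is a compact convex subset of $\mathbb{R}^n$; $\mathcal{L}^n_j$ is the set of $j$-dimensional linear subspaces. For convex bodies $K,C$ and $1\le i\le n$: $\mathrm{R}_i(K,C)$ is the smallest $\rho\geq 0$ such that $K\subset x+\rho C+L$ for some $L\in\mathcal{L}^n_{n-i}$ and $x\in\mathbb{R}^n$; $\mathrm{r}_i(K,C)$ is the largest $\rho\geq0$ such that $x+\rho(C\cap L)\subset K$ for some $L\in\mathcal{L}^n_i$ and $x\in\mathbb{R}^n$. *)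

(* Defs.v *)
From HB Require Import structures.
From mathcomp Require Import all_boot all_order all_algebra.
From mathcomp Require Import all_classical all_reals all_analysis.
Set Implicit Arguments. Unset Strict Implicit. Unset Printing Implicit Defensive.
Import Order.TTheory GRing.Theory Num.Theory.
Import numFieldNormedType.Exports.
Local Open Scope classical_set_scope.
Local Open Scope ring_scope.

Definition is_norm (R : realType) (n : nat) (N : 'rV[R]_n -> R) : Prop :=
  [/\ forall x, 0 <= N x,
      forall x, N x = 0 -> x = 0,
      forall (a : R) x, N (a *: x) = `|a| * N x
    & forall x y, N (x + y) <= N x + N y].

Definition unit_ball (R : realType) (n : nat) (N : 'rV[R]_n -> R) : set 'rV[R]_n :=
  [set x | N x <= 1].

Definition eucl_ball (R : realType) (n : nat) : set 'rV[R]_n :=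
  [set x | \sum_(j < n) x ord0 j ^+ 2 <= 1].

Definition convex_set (R : realType) (n : nat) (K : set 'rV[R]_n) : Prop :=
  forall x y (t : R), K x -> K y -> 0 <= t -> t <= 1 ->
    K (t *: x + (1 - t) *: y).

Definition convex_body (R : realType) (n : nat) (K : set 'rV[R]_n) : Prop :=
  compact K /\ convex_set K.

Definition symmetric0 (R : realType) (n : nat) (K : set 'rV[R]_n) : Prop :=
  forall x, K x -> K (- x).

(* Linear subspaces of dimension j are represented by square matrices L
   with \rank L = j; v lies in L iff (v <= L)%MS. *)

Definition circumR (R : realType) (n : nat) (i : nat)
  (K C : set 'rV[R]_n) : R :=
  inf [set rho : R | 0 <= rho /\
        exists (L : 'M[R]_n) (x : 'rV[R]_n), \rank L = (n - i)%N /\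
          forall y, K y -> exists c l, C c /\ (l <= L)%MS /\
             y = x + rho *: c + l].

Definition inr (R : realType) (n : nat) (i : nat)
  (K C : set 'rV[R]_n) : R :=
  sup [set rho : R | 0 <= rho /\
        exists (L : 'M[R]_n) (x : 'rV[R]_n), \rank L = i /\
          forall c, C c -> (c <= L)%MS -> K (x + rho *: c)].

(* Main.v *)
Require Import Defs.
From HB Require Import structures.
From mathcomp Require Import all_boot all_order all_algebra.
From mathcomp Require Import all_classical all_reals all_analysis.
From mathcomp Require Import perm ring lra.
Set Implicit Arguments. Unset Strict Implicit. Unset Printing Implicit Defensive.
Import Order.TTheory GRing.Theory Num.Theory.
Import numFieldNormedType.Exports.
Local Open Scope classical_set_scope.
Local Open Scope ring_scope.

(** By John's theorem [K] lies between an ellipsoid [E] and a homothetic copy of ratio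
    [n] ([sqrt n] when [K] is symmetric), and [B] lies between an ellipsoid [F] and
    [sqrt n F], with [F = B] when [B] is Euclidean.  Diagonalising [E] against [F], the
    [i]-th largest semi-axis [a] of [E] relative to [F] satisfies both
    [a (F :&: V) <= E] for a subspace [V] of dimension [i] and [E <= a F + U] for a
    subspace [U] of dimension [i - 1], so the ratio of the two radii is at most the
    product of the two John ratios.

    John's theorem is only needed up to a factor [1 + epsilon].  If a convex set
    contains the Euclidean unit ball and a point far away, their convex hull contains
    an ellipsoid whose volume exceeds that of the ball by a fixed factor; hence an
    inscribed ellipsoid of nearly maximal volume does the job, taken in the affine hull
    of [K] because [K] may be flat. *)

(** * Inner product, rank-one stretches and the hull of a ball and a point *)

Definition dot {R : realType} {k : nat} (u v : 'rV[R]_k) : R := (u *m v^T) 0 0.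

Section Dot.
Variables (R : realType) (k : nat).
Implicit Types (u v w : 'rV[R]_k).

Lemma dotE u v : dot u v = \sum_j u 0 j * v 0 j.
Proof. by rewrite /dot mxE; apply: eq_bigr => j _; rewrite mxE. Qed.

Lemma dot_mulmxE u v : u *m v^T = (dot u v)%:M.
Proof. by rewrite [LHS]mx11_scalar. Qed.

Lemma dotC u v : dot u v = dot v u.
Proof. by rewrite !dotE; apply: eq_bigr => j _; rewrite mulrC. Qed.

Lemma dotDl u v w : dot (u + v) w = dot u w + dot v w.
Proof. by rewrite /dot mulmxDl mxE. Qed.

Lemma dotZl a u v : dot (a *: u) v = a * dot u v.
Proof. by rewrite /dot -scalemxAl mxE. Qed.

Lemma dotDr u v w : dot w (u + v) = dot w u + dot w v.
Proof. by rewrite dotC dotDl !(dotC _ w). Qed.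

Lemma dotZr a u v : dot u (a *: v) = a * dot u v.
Proof. by rewrite dotC dotZl dotC. Qed.

Lemma dotNl u v : dot (- u) v = - dot u v.
Proof. by rewrite -scaleN1r dotZl mulN1r. Qed.

Lemma dotNr u v : dot u (- v) = - dot u v.
Proof. by rewrite dotC dotNl dotC. Qed.

Lemma dot0l v : dot 0 v = 0.
Proof. by rewrite /dot mul0mx mxE. Qed.

Lemma dot0r v : dot v 0 = 0.
Proof. by rewrite dotC dot0l. Qed.

Definition dot_lin := (dotDl, dotDr, dotZl, dotZr, dotNl, dotNr).

Lemma dot_ge0 u : 0 <= dot u u.
Proof. by rewrite dotE sumr_ge0 // => j _; rewrite -expr2 sqr_ge0. Qed.

Lemma dot_eq0 u : (dot u u == 0) = (u == 0).
Proof.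
apply/idP/eqP => [|->]; last by rewrite dot0l.
rewrite dotE psumr_eq0 => [/allP u0|j _]; last by rewrite -expr2 sqr_ge0.
apply/rowP => j; rewrite mxE; apply/eqP.
by have := u0 j (mem_index_enum j); rewrite /= mulf_eq0 orbb.
Qed.

Lemma dot_gt0 u : (0 < dot u u) = (u != 0).
Proof. by rewrite lt_def dot_ge0 andbT dot_eq0. Qed.

Lemma dot_mulmxl j (A : 'M[R]_(j, k)) (c : 'rV[R]_j) v :
  dot (c *m A) v = dot c (v *m A^T).
Proof. by rewrite /dot trmx_mul trmxK mulmxA. Qed.

Lemma coord_sqr_le_dot u j : u 0 j ^+ 2 <= dot u u.
Proof.
rewrite dotE (bigD1 j) //= -expr2 lerDl sumr_ge0 // => l _.
by rewrite -expr2 sqr_ge0.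
Qed.

Lemma dot_sqr_le u v : dot v v = 1 -> dot u v ^+ 2 <= dot u u.
Proof.
move=> v1; have := dot_ge0 (u - dot u v *: v).
by rewrite !dot_lin v1 (dotC v u); nra.
Qed.

Lemma normalize u : u != 0 ->
  dot ((Num.sqrt (dot u u))^-1 *: u) ((Num.sqrt (dot u u))^-1 *: u) = 1.
Proof.
move=> u0; have /lt0r_neq0 u1 : 0 < dot u u by rewrite dot_gt0.
by rewrite !dot_lin mulrA -expr2 exprVn sqr_sqrtr ?dot_ge0 // mulVf.
Qed.

(** For a unit vector [e], this symmetric matrix scales by [a] along [e] and by [b] on the
    orthogonal complement. *)
Definition stretch (a b : R) (e : 'rV[R]_k) : 'M[R]_k :=
  b%:M + (a - b) *: (e^T *m e).

Lemma mulmx_stretch a b e u :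
  u *m stretch a b e = b *: u + ((a - b) * dot u e) *: e.
Proof.
by rewrite mulmxDr mul_mx_scalar -scalemxAr mulmxA dot_mulmxE mul_scalar_mx scalerA.
Qed.

(** A case of the matrix determinant lemma: conjugating by the unitriangular block matrix [Lo] moves
    the rank-one term into the scalar block, and determinants of both sides are compared. *)
Lemma det_add_rank1 (x : R) (e : 'rV[R]_k) : dot e e = 1 ->
  \det (1%:M + x *: (e^T *m e)) = 1 + x.
Proof.
move=> e1; pose Lo := block_mx (1%:M : 'M[R]_1) 0 e^T (1%:M : 'M[R]_k).
have LU : Lo *m block_mx 1%:M (- x *: e) 0 (1%:M + x *: (e^T *m e)) =
          block_mx (1 + x)%:M (- x *: e) 0 1%:M *m Lo.
  rewrite /Lo !mulmx_block !mul1mx !mulmx1 !mul0mx !mulmx0 !addr0 !add0r.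
  congr block_mx; first by rewrite -scalemxAl dot_mulmxE e1 scale_scalar_mx -raddfD mulr1 addrK.
  by rewrite -scalemxAr scaleNr addrCA addNr addr0.
have := congr1 determinant LU.
by rewrite !det_mulmx !det_lblock !det_ublock !det1 det_scalar1 !mul1r !mulr1.
Qed.

Lemma det_stretch a b e : (0 < k)%N -> b != 0 -> dot e e = 1 ->
  \det (stretch a b e) = a * b ^+ k.-1.
Proof.
move=> k0 b0 e1.
have -> : stretch a b e = b *: (1%:M + ((a - b) / b) *: (e^T *m e)).
  by rewrite scalerDr scale_scalar_mx mulr1 scalerA mulrCA mulfV // mulr1.
rewrite detZ det_add_rank1 // -[in b ^+ k](prednK k0) exprS.
by field.
Qed.

(** The ball of radius [1 - t] about [t *: y] is the convex combination of [y] and the unit ball.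
    For [t = 1] it shrinks to the point [y], and rescaling by [1 - t] is impossible. *)
Lemma hull_ball_point (Q : set 'rV[R]_k) (x y : 'rV[R]_k) (t : R) :
  Defs.convex_set Q -> (forall u, dot u u <= 1 -> Q u) -> Q y ->
  0 <= t -> t <= 1 -> dot (x - t *: y) (x - t *: y) <= (1 - t) ^+ 2 -> Q x.
Proof.
move=> cQ ballQ Qy t0 t1 dxy.
have [t1e|t1n] := eqVneq t 1.
  move: dxy; rewrite t1e subrr expr0n /= scale1r => dxy.
  have : dot (x - y) (x - y) == 0 by rewrite eq_le dxy dot_ge0.
  by rewrite dot_eq0 subr_eq0 => /eqP ->.
have t2 : 0 < 1 - t by rewrite subr_gt0 lt_neqAle t1n.
have -> : x = t *: y + (1 - t) *: ((1 - t)^-1 *: (x - t *: y)).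
  by rewrite scalerA mulfV ?lt0r_neq0 // scale1r addrC subrK.
apply: cQ => //; apply: ballQ.
rewrite dotZl dotZr mulrA -expr2 exprVn mulrC ler_pdivrMr ?mul1r //.
by rewrite exprn_gt0.
Qed.

End Dot.

(** * Scalar inequalities behind the enlarged ellipsoids *)

Section Scalar.
Variable R : realType.
Implicit Types (s d c b : R).

(* The point with coordinate [d + (1 + d) * c] along the axis, at squared distance
   [b2 * (1 - c ^+ 2)] from it, lies in the hull of the unit ball and of the point at
   abscissa [s]: it is within [1 - t] of [t] times that point.  The first case uses the
   optimal [t]. *)
Lemma ice_cream_cone s d c (b2 : R) : 1 < s -> 0 <= d -> 2 * d <= s - 1 ->
  b2 * (s - 1) = s - 1 - 2 * d -> -1 <= c -> c <= 1 ->
  exists t, [/\ 0 <= t, t <= 1 &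
    (d + (1 + d) * c - t * s) ^+ 2 + b2 * (1 - c ^+ 2) <= (1 - t) ^+ 2].
Proof.
move=> s1 d0 ds b2E c1 c2.
pose x := d + (1 + d) * c.
have s21 : 0 < s ^+ 2 - 1 by nra.
have [sx|sx] := lerP 1 (s * x).
  exists ((s * x - 1) / (s ^+ 2 - 1)).
  have xs : x <= s by rewrite /x; nra.
  split; first by apply: divr_ge0; lra.
    by rewrite ler_pdivrMr // mul1r; nra.
  rewrite -/x -subr_ge0.
  have -> : (1 - (s * x - 1) / (s ^+ 2 - 1)) ^+ 2 -
     ((x - (s * x - 1) / (s ^+ 2 - 1) * s) ^+ 2 + b2 * (1 - c ^+ 2)) =
     ((1 + d) - (s - d) * c) ^+ 2 / (s ^+ 2 - 1).
    have -> : b2 = (s - 1 - 2 * d) / (s - 1).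
      by rewrite -b2E mulfK //; lra.
    rewrite /x; field.
    by apply/andP; split; lra.
  by rewrite divr_ge0 ?sqr_ge0 // ltW.
(* For [s * x < 1] the optimal [t] would be negative; with [t = 0] the claim is that the point lies
   in the unit ball itself. *)
exists 0; split => //; rewrite ?ler01 // mul0r !subr0 expr1n -/x.
have s1' : 0 < s - 1 by lra.
have b21 : b2 <= 1.
  by rewrite -(ler_pM2r s1') b2E; lra.
have x1 : 0 <= 1 + x by rewrite /x; nra.
have key : 0 <= (1 - x) * (1 + d) ^+ 2 - b2 * (1 + 2 * d - x).
  suff : 0 <= s * (s - 1) * ((1 - x) * (1 + d) ^+ 2 - b2 * (1 + 2 * d - x)).
    by rewrite pmulr_rge0 // mulr_gt0 //; lra.
  have -> : s * (s - 1) * ((1 - x) * (1 + d) ^+ 2 - b2 * (1 + 2 * d - x)) =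
     (1 - s * x) * ((s - 1) * (1 + d) ^+ 2 - b2 * (s - 1)) +
     ((s - 1) ^+ 2 * (1 + d) ^+ 2 - (b2 * (s - 1)) * (s - 1 + 2 * d * s)).
    by ring.
  rewrite b2E addr_ge0 //.
    by apply: mulr_ge0; nra.
  have -> : (s - 1) ^+ 2 * (1 + d) ^+ 2 - (s - 1 - 2 * d) * (s - 1 + 2 * d * s) =
    d ^+ 2 * ((s - 1) ^+ 2 + 4 * s) by ring.
  by rewrite mulr_ge0 ?sqr_ge0 // addr_ge0 ?sqr_ge0 //; lra.
have d1 : 0 < (1 + d) ^+ 2 by rewrite exprn_gt0 //; lra.
rewrite -subr_ge0 -(pmulr_rge0 _ d1).
have -> : (1 + d) ^+ 2 * (1 - (x ^+ 2 + b2 * (1 - c ^+ 2))) =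
  (1 + x) * ((1 - x) * (1 + d) ^+ 2 - b2 * (1 + 2 * d - x)).
  by rewrite /x; ring.
exact: mulr_ge0.
Qed.

(* Symmetric analogue, with semi-axes [a] and [sqrt (1 - th)] and centre [0]. *)
Lemma lens_hull s (th a c : R) : 1 < s -> 0 <= th -> th < 1 -> 0 < a ->
  a ^+ 2 = 1 - th + th * s ^+ 2 -> 0 <= c -> c <= 1 ->
  exists t, [/\ 0 <= t, t <= 1 &
    (a * c - t * s) ^+ 2 + (1 - th) * (1 - c ^+ 2) <= (1 - t) ^+ 2].
Proof.
(* With this [t] the difference of the two sides is exactly [th * (1 - c / a * s) ^+ 2]. *)
move=> s1 th0 th1 a0 a2E c0 c1; exists (th * s * c / a).
have a0' : a != 0 by rewrite gt_eqF.
split; first by rewrite divr_ge0 ?mulr_ge0 //; lra.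
  rewrite ler_pdivrMr // mul1r.
  suff : (th * s * c) ^+ 2 <= a ^+ 2.
    by rewrite ler_pXn2r // ?nnegrE ?mulr_ge0 //; lra.
  rewrite a2E !exprMn.
  have : th ^+ 2 <= th by rewrite expr2; nra.
  have : c ^+ 2 <= 1 by rewrite expr_le1.
  move=> c21 th2; have s20 := sqr_ge0 s.
  apply: (@le_trans _ _ (th ^+ 2 * s ^+ 2)).
    by rewrite ler_piMr // mulr_ge0 ?sqr_ge0.
  apply: (@le_trans _ _ (th * s ^+ 2)); first by rewrite ler_wpM2r.
  by lra.
pose q := c / a; have cE : c = q * a by rewrite mulfVK.
have -> : th * s * c / a = th * s * q by rewrite mulrA.
rewrite cE mulrCA -expr2 exprMn a2E -subr_ge0.
set lhs := (X in 0 <= X); have -> : lhs = th * (1 - q * s) ^+ 2.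
  by rewrite /lhs; ring.
by rewrite mulr_ge0 ?sqr_ge0.
Qed.

Lemma bernoulli_sub (x : R) m : 0 <= x -> x <= 1 -> 1 - m%:R * x <= (1 - x) ^+ m.
Proof.
move=> x0 x1; elim: m => [|m IH]; first by rewrite mul0r subr0 expr0.
rewrite exprS -natr1; apply: (@le_trans _ _ ((1 - x) * (1 - m%:R * x))).
  have : 0 <= m%:R * x * x by rewrite !mulr_ge0.
  by lra.
by rewrite ler_wpM2l // subr_ge0.
Qed.

End Scalar.

(** * Ellipsoids larger than the unit ball in the hull of the ball and a far point *)

Section Enlarge.
Variables (R : realType) (k : nat).
Implicit Types (Q : set 'rV[R]_k) (e u : 'rV[R]_k) (s : R).

(** Shifting the centre towards the far point lets the axis along [e] grow at the cost of the
    others, and the growth wins once [s] exceeds the dimension. [q] is fixed before [Q] and [e]: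
    this uniform gain is what permits a nearly maximal ellipsoid in place of a maximal one. *)
Lemma enlarge_ball s : (0 < k)%N -> k%:R < s ->
  exists2 q : R, 1 < q & forall Q e, Defs.convex_set Q ->
    (forall u, dot u u <= 1 -> Q u) -> dot e e = 1 -> Q (s *: e) ->
    exists c W, (forall u, dot u u <= 1 -> Q (c + u *m W)) /\ q <= `|\det W|.
Proof.
move=> k0 ks.
have k1 : 1 <= k%:R :> R by rewrite ler1n.
have s1 : 1 < s by exact: le_lt_trans k1 ks.
(* [d] is small enough for the first-order gain [2 * d * (s - k) / (s - 1)] of the
   squared volume to dominate. *)
pose d := (s - k%:R) / (4 * s).
have s0 : 0 < 4 * s by lra.
have dE : d * (4 * s) = s - k%:R by rewrite mulfVK // gt_eqF.
have d0 : 0 < d by rewrite divr_gt0 //; lra.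
have d2 : 2 * d < s - 1 by nra.
have s10 : 0 < s - 1 by lra.
pose b2 := 1 - 2 * d / (s - 1).
have b2E : b2 * (s - 1) = s - 1 - 2 * d.
  by rewrite mulrBl mul1r mulfVK // gt_eqF.
have b20 : 0 < b2 by rewrite -(pmulr_lgt0 _ s10) b2E; lra.
pose b := Num.sqrt b2.
have b0 : 0 < b by rewrite sqrtr_gt0.
have bE : b ^+ 2 = b2 by rewrite sqr_sqrtr // ltW.
exists ((1 + d) * b ^+ k.-1).
  suff : 1 ^+ 2 < ((1 + d) * b ^+ k.-1) ^+ 2.
    by rewrite ltr_pXn2r // nnegrE // mulr_ge0 ?exprn_ge0 ?ltW //; lra.
  rewrite expr1n exprMn -exprM mulnC exprM bE.
  have x0 : 0 <= 2 * d / (s - 1) by apply: divr_ge0; lra.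
  have x1 : 2 * d / (s - 1) <= 1 by rewrite ler_pdivrMr // mul1r; lra.
  apply: (@lt_le_trans _ _ ((1 + d) ^+ 2 * (1 - k.-1%:R * (2 * d / (s - 1))))); last first.
    by rewrite ler_wpM2l ?sqr_ge0 // bernoulli_sub.
  have -> : k.-1%:R = k%:R - 1 :> R by rewrite -[in RHS](prednK k0) -natr1 addrK.
  rewrite -subr_gt0 -(pmulr_lgt0 _ s10).
  have -> : ((1 + d) ^+ 2 * (1 - (k%:R - 1) * (2 * d / (s - 1))) - 1) * (s - 1) =
    (1 + d) ^+ 2 * (s - 1 - (k%:R - 1) * (2 * d)) - (s - 1).
    by field; rewrite gt_eqF.
  have kE : k%:R = s - d * (4 * s) by lra.
  rewrite kE; set r := s - _ - 1; have r0 : 0 <= r by rewrite /r -kE; lra.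
  have rE : r = s - 1 - 4 * d * s by rewrite /r; ring.
  have : 0 < s - 1 - r * (2 * d) by nra.
  nra.
move=> Q e cQ ballQ e1 Qse; exists (d *: e), (stretch (1 + d) b e).
split; last first.
  rewrite det_stretch ?gt_eqF // ger0_norm // mulr_ge0 ?exprn_ge0 ?ltW //; lra.
move=> u u1; rewrite mulmx_stretch.
pose c := dot u e.
have c2 : c ^+ 2 <= dot u u by exact: dot_sqr_le.
have [c1 c1'] : -1 <= c /\ c <= 1 by split; nra.
have [t [t0 t1 ht]] := ice_cream_cone s1 (ltW d0) (ltW d2) b2E c1 c1'.
apply: (hull_ball_point cQ ballQ Qse t0 t1).
apply: le_trans ht.
rewrite !dot_lin e1 (dotC e u) -/c -bE.
have : b ^+ 2 * dot u u <= b ^+ 2 by rewrite ler_piMr ?sqr_ge0.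
nra.
Qed.

(** The centre stays at the origin because both [s *: e] and its opposite are available, which
    lowers the threshold on [s] from [k] to [sqrt k]. *)
Lemma enlarge_ball_sym s : (0 < k)%N -> 0 < s -> k%:R < s ^+ 2 ->
  exists2 q : R, 1 < q & forall Q e, Defs.convex_set Q -> symmetric0 Q ->
    (forall u, dot u u <= 1 -> Q u) -> dot e e = 1 -> Q (s *: e) ->
    exists2 W, (forall u, dot u u <= 1 -> Q (u *m W)) & q <= `|\det W|.
Proof.
move=> k0 s0 ks.
have k1 : 1 <= k%:R :> R by rewrite ler1n.
have s1 : 1 < s by rewrite -(ltr_pXn2r (isT : (0 < 2)%N)) ?nnegrE ?ltW // expr1n; lra.
have s20 : 0 < 2 * s ^+ 2 * k%:R by nra.
(* The squared volume gains [th * (s ^+ 2 - k%:R)] to first order; this [th] is small enough to keep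
   the quadratic loss below that gain. *)
pose th := (s ^+ 2 - k%:R) / (2 * s ^+ 2 * k%:R).
have thE : th * (2 * s ^+ 2 * k%:R) = s ^+ 2 - k%:R by rewrite mulfVK // gt_eqF.
have th0 : 0 < th by rewrite divr_gt0 //; lra.
have th1 : th < 1 by rewrite ltr_pdivrMr // mul1r; nra.
pose a := Num.sqrt (1 - th + th * s ^+ 2).
pose b := Num.sqrt (1 - th).
have a20 : 0 < 1 - th + th * s ^+ 2 by nra.
have aE : a ^+ 2 = 1 - th + th * s ^+ 2 by rewrite sqr_sqrtr // ltW.
have bE : b ^+ 2 = 1 - th by rewrite sqr_sqrtr //; lra.
have a0 : 0 < a by rewrite sqrtr_gt0.
have b0 : 0 < b by rewrite sqrtr_gt0; lra.
exists (a * b ^+ k.-1).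
  suff : 1 ^+ 2 < (a * b ^+ k.-1) ^+ 2.
    by rewrite ltr_pXn2r // nnegrE // mulr_ge0 ?exprn_ge0 ?ltW.
  rewrite expr1n exprMn -exprM mulnC exprM bE aE.
  apply: (@lt_le_trans _ _ ((1 - th + th * s ^+ 2) * (1 - k.-1%:R * th))); last first.
    by rewrite (ler_wpM2l (ltW a20)) // bernoulli_sub // ltW.
  have -> : k.-1%:R = k%:R - 1 :> R by rewrite -[in RHS](prednK k0) -natr1 addrK.
  rewrite -subr_gt0; set X := (X in 0 < X).
  have -> : X = th * ((s ^+ 2 - k%:R) - th * (s ^+ 2 - 1) * (k%:R - 1)).
    by rewrite /X; ring.
  rewrite mulr_gt0 // subr_gt0 -thE -subr_gt0.
  set Y := (X in 0 < X).
  have -> : Y = th * (s ^+ 2 * k%:R + s ^+ 2 + k%:R - 1) by rewrite /Y; ring.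
  by rewrite mulr_gt0 //; nra.
move=> Q e cQ sQ ballQ e1 Qse; exists (stretch a b e); last first.
  by rewrite det_stretch ?gt_eqF // ger0_norm // mulr_ge0 ?exprn_ge0 ?ltW.
have pos u : dot u u <= 1 -> 0 <= dot u e -> Q (u *m stretch a b e).
  move=> u1; rewrite mulmx_stretch; set c := dot u e => c0.
  have c2 : c ^+ 2 <= dot u u by exact: dot_sqr_le.
  have c1 : c <= 1 by nra.
  have [t [t0 t1 ht]] := lens_hull s1 (ltW th0) th1 a0 aE c0 c1.
  apply: (hull_ball_point cQ ballQ Qse t0 t1).
  apply: le_trans ht.
  rewrite !dot_lin e1 (dotC e u) -/c -bE.
  have : b ^+ 2 * dot u u <= b ^+ 2 by rewrite ler_piMr ?sqr_ge0.
  nra.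
move=> u u1; have [|ue] := lerP 0 (dot u e); first exact: pos.
rewrite -[u]opprK mulNmx; apply/sQ/pos; rewrite !dot_lin; lra.
Qed.

End Enlarge.

(** * John's theorem up to an arbitrarily small loss *)

Section John.
Variables (R : realType).

Definition coord_bounded n (K : set 'rV[R]_n) :=
  exists D : R, forall y j, K y -> `|y 0 j| <= D.

Lemma det_norm_le k (A : 'M[R]_k) (D : R) : (forall i j, `|A i j| <= D) ->
  `|\det A| <= \sum_(s : {perm 'I_k}) D ^+ k.
Proof.
move=> AD; apply: (le_trans (ler_norm_sum _ _ _)); apply: ler_sum => s _.
rewrite normrM normrX normrN1 expr1n mul1r normr_prod.
rewrite -[X in _ <= _ ^+ X]card_ord -prodr_const.
by apply: ler_prod => i _; rewrite normr_ge0 AD.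
Qed.

(** The ellipsoid is the image of the unit ball under [u |-> c + u *m T]; for square [T] its volume
    relative to the ball is the absolute value of the determinant. A non-square [T] accommodates
    flat bodies. *)
Definition inscribed k n (K : set 'rV[R]_n) (c : 'rV[R]_n) (T : 'M[R]_(k, n)) :=
  forall u : 'rV[R]_k, dot u u <= 1 -> K (c + u *m T).

Lemma dot_delta k (i : 'I_k) : dot (delta_mx 0 i) (delta_mx 0 i : 'rV[R]_k) = 1.
Proof.
rewrite dotE (bigD1 i) //= big1 => [|j ji]; first by rewrite !mxE !eqxx mulr1 addr0.
by rewrite !mxE eqxx /= (negbTE ji) mul0r.
Qed.

(** Each row of [A] is a difference of two points of [Q], so the entries are bounded, and the
    Leibniz expansion bounds the determinant. *)
Lemma inscribed_det_bounded k (Q : set 'rV[R]_k) : coord_bounded Q ->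
  exists D : R, forall c A, inscribed Q c A -> `|\det A| <= D.
Proof.
move=> [D QD]; exists (\sum_(s : {perm 'I_k}) (D + D) ^+ k) => c A QA.
apply: det_norm_le => i j.
have Q1 : Q (c + delta_mx 0 i *m A) by apply: QA; rewrite dot_delta.
have Q0 : Q c.
  have := QA 0; rewrite mul0mx addr0; apply.
  by rewrite dot0l.
have := QD _ j Q1; have := QD _ j Q0; rewrite -rowE mxE (mxE _ _ 0 j) => h1 h2.
have -> : A i j = (c 0 j + A i j) - c 0 j by rewrite addrAC subrr add0r.
by rewrite (le_trans (ler_normB _ _)) // lerD.
Qed.

(** Taking a value close to the supremum of the volumes avoids any compactness argument. The set [C]
    restricts the centres: everything in the general case, only the origin in the symmetric one. *)
Lemma near_maximal_ellipsoid k (Q C : set 'rV[R]_k) (q : R) :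
  coord_bounded Q -> 1 < q ->
  (exists c A, [/\ C c, inscribed Q c A & A \in unitmx]) ->
  exists c A, [/\ C c, inscribed Q c A, A \in unitmx &
    forall c' A', C c' -> inscribed Q c' A' -> `|\det A'| < q * `|\det A|].
Proof.
move=> bQ q1 [c0 [A0 [Cc0 QA0 uA0]]].
have [D QD] := inscribed_det_bounded bQ.
pose V := [set v : R | exists c A, [/\ C c, inscribed Q c A & v = `|\det A|]].
have V0 : V `|\det A0| by exists c0, A0.
have hV : has_sup V.
  by split; [exists `|\det A0| | exists D => _ [c [A [_ QA ->]]]; exact: QD QA].
have A00 : 0 < `|\det A0| by rewrite normr_gt0 -unitfE -unitmxE.
have sV : 0 < sup V by apply: lt_le_trans A00 _; exact: sup_upper_bound.
have q0 : 0 < q by lra.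
(* Any volume above [sup V / q] leaves no room for a further factor [q]. *)
have sq : sup V / q < sup V by rewrite ltr_pdivrMr // ltr_pMr.
have gap : 0 < sup V - sup V / q by rewrite subr_gt0.
have [_ [c [A [Cc QA ->]]]] := sup_adherent gap hV.
rewrite opprB addrCA subrr addr0 => lA; exists c, A; split => //.
  rewrite unitmxE unitfE -normr_gt0; apply: lt_trans lA; exact: divr_gt0.
move=> c' A' Cc' QA'; rewrite mulrC -ltr_pdivrMr //; apply: le_lt_trans lA.
by rewrite ler_pM2r ?invr_gt0 //; apply: sup_upper_bound => //; exists c', A'.
Qed.

Lemma convex_segment n (K : set 'rV[R]_n) (c v : 'rV[R]_n) (a b : R) :
  Defs.convex_set K -> K c -> K (c + a *: v) -> 0 <= b -> b <= a -> K (c + b *: v).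
Proof.
move=> cK Kc Ka b0 ba.
have [a0|a0] := eqVneq a 0.
  have -> : b = 0 by apply/eqP; rewrite eq_le b0 -a0 ba.
  by rewrite scale0r addr0.
have -> : c + b *: v = (b / a) *: (c + a *: v) + (1 - b / a) *: c.
  by rewrite scalerDr scalerA mulfVK // addrAC -scalerDl (addrC (b / a)) subrK scale1r.
have a1 : 0 < a by rewrite lt_def a0 /=; lra.
by apply: cK => //; [exact: divr_ge0 (ltW a1) | rewrite ler_pdivrMr // mul1r].
Qed.

(** If a point of [Q] had norm above [s] in the coordinates of a nearly maximal ellipsoid, convexity
    would supply one at norm exactly [s] in the same direction, and [enl] would then enlarge the
    ellipsoid by the forbidden factor [q]. *)
Lemma john_core k (Q C : set 'rV[R]_k) (q s : R) :
  Defs.convex_set Q -> coord_bounded Q -> 1 < q -> 0 < s ->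
  (exists c A, [/\ C c, inscribed Q c A & A \in unitmx]) ->
  (forall c A e, C c -> inscribed Q c A -> dot e e = 1 -> Q (c + s *: (e *m A)) ->
     exists c' A', [/\ C c', inscribed Q c' A' & q * `|\det A| <= `|\det A'|]) ->
  exists c A, [/\ C c, inscribed Q c A, A \in unitmx &
    forall y, Q y -> exists2 u, dot u u <= s ^+ 2 & y = c + u *m A].
Proof.
move=> cQ bQ q1 s0 ini enl.
have [c [A [Cc QA uA maxA]]] := near_maximal_ellipsoid bQ q1 ini.
exists c, A; split => // y Qy; exists ((y - c) *m invmx A); last first.
  by rewrite mulmxKV // addrC subrK.
set u := _ *m _; have yE : y = c + u *m A by rewrite mulmxKV // addrC subrK.
rewrite leNgt; apply/negP => su.
have u0 : u != 0 by rewrite -dot_gt0; apply: lt_trans su; rewrite exprn_gt0.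
pose r := Num.sqrt (dot u u).
have r0 : 0 < r by rewrite sqrtr_gt0 dot_gt0.
have sr : s <= r.
  by rewrite -(ler_pXn2r (isT : (0 < 2)%N)) ?nnegrE ?ltW // sqr_sqrtr ?dot_ge0 // ltW.
have Qc : Q c.
  have := QA 0; rewrite mul0mx addr0; apply.
  by rewrite dot0l.
have Qs : Q (c + s *: (r^-1 *: u *m A)).
  apply: (convex_segment cQ Qc _ (ltW s0) sr).
  by rewrite -scalemxAl scalerA mulfV ?gt_eqF // scale1r -yE.
have [c' [A' [Cc' QA' lA']]] := enl _ _ _ Cc QA (normalize u0) Qs.
by have := maxA _ _ Cc' QA'; rewrite ltNge lA'.
Qed.

Lemma convex_affine_preim k n (K : set 'rV[R]_n) c (T : 'M[R]_(k, n)) :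
  Defs.convex_set K -> Defs.convex_set [set z | K (c + z *m T)].
Proof.
move=> cK x y t Kx Ky t0 t1 /=.
have -> : c + (t *: x + (1 - t) *: y) *m T =
  t *: (c + x *m T) + (1 - t) *: (c + y *m T).
  rewrite mulmxDl -!scalemxAl !scalerDr addrACA -scalerDl (addrC t).
  by rewrite subrK scale1r.
exact: cK.
Qed.

Lemma john_full k (Q : set 'rV[R]_k) (s : R) :
  Defs.convex_set Q -> coord_bounded Q -> 0 < s -> k%:R < s ->
  (exists c A, inscribed Q c A /\ A \in unitmx) ->
  exists c A, [/\ inscribed Q c A, A \in unitmx &
    forall y, Q y -> exists2 u, dot u u <= s ^+ 2 & y = c + u *m A].
Proof.
(* Dimension 0 is separate: there is no direction to enlarge in, and the centre is the only
   point. *)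
case: k Q => [|k] Q cQ bQ s0 ks [c0 [A0 [QA0 uA0]]].
  exists c0, A0; split => // y _; exists 0; last by apply/rowP => -[].
  by rewrite dotE big_ord0 sqr_ge0.
have [q q1 enl] := enlarge_ball (ltn0Sn k) ks.
have [||c [A [_ QA uA hA]]] := @john_core _ Q setT q s cQ bQ q1 s0.
- by exists c0, A0.
- move=> c A e _ QA e1; rewrite scalemxAl => Qs.
  (* In the coordinates of the ellipsoid, the preimage of [Q] contains the unit ball and [s *: e];
     determinants multiply on the way back. *)
  have [c' [W [QW qW]]] := enl _ e (convex_affine_preim cQ) QA e1 Qs.
  exists (c + c' *m A), (W *m A); split=> //.
    by move=> u /QW; rewrite /= mulmxDl addrA mulmxA.
  by rewrite det_mulmx normrM ler_wpM2r.
by exists c, A.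
Qed.

Lemma john_full_sym k (Q : set 'rV[R]_k) (s : R) :
  Defs.convex_set Q -> symmetric0 Q -> coord_bounded Q -> 0 < s -> k%:R < s ^+ 2 ->
  (exists2 A, inscribed Q 0 A & A \in unitmx) ->
  exists A, [/\ inscribed Q 0 A, A \in unitmx &
    forall y, Q y -> exists2 u, dot u u <= s ^+ 2 & y = u *m A].
Proof.
case: k Q => [|k] Q cQ sQ bQ s0 ks [A0 QA0 uA0].
  exists A0; split => // y _; exists 0; last by apply/rowP => -[].
  by rewrite dotE big_ord0 sqr_ge0.
have [q q1 enl] := enlarge_ball_sym (ltn0Sn k) s0 ks.
have [||c [A [c0 QA uA hA]]] := @john_core _ Q [set 0] q s cQ bQ q1 s0.
- by exists 0, A0.
- move=> _ A e -> QA e1; rewrite scalemxAl => Qs.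
  have sQ' : symmetric0 [set z | Q (0 + z *m A)].
    by move=> x /=; rewrite !add0r mulNmx; exact: sQ.
  have [W QW qW] := enl _ e (convex_affine_preim cQ) sQ' QA e1 Qs.
  exists 0, (W *m A); split=> //.
    by move=> u /QW; rewrite /= mulmxA.
  by rewrite det_mulmx normrM ler_wpM2r.
move: c0 QA hA => -> QA hA; exists A; split => // y /hA [u u1 ->].
by exists u => //; rewrite add0r.
Qed.

(** * Initial ellipsoids, and passage to the affine hull *)

Lemma convex_subcomb n (K : set 'rV[R]_n) (I : eqType) (r : seq I) (w : I -> R)
    (p : I -> 'rV[R]_n) :
  Defs.convex_set K -> K 0 -> (forall j, K (p j)) -> (forall j, 0 <= w j) ->
  \sum_(j <- r) w j <= 1 -> K (\sum_(j <- r) w j *: p j).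
Proof.
move=> cK K0 Kp; elim: r w => [|i r IH] w w0; first by rewrite !big_nil.
rewrite !big_cons => w1.
have r0 : 0 <= \sum_(j <- r) w j by exact: sumr_ge0.
(* Otherwise the remaining weights are renormalised by [1 - w i]; when this vanishes, so do they. *)
have [wi|wi] := eqVneq (w i) 1.
  have : \sum_(j <- r) w j == 0 by rewrite eq_le r0 andbT; lra.
  rewrite psumr_eq0 // => /allP wz; rewrite big_seq big1 ?addr0 ?wi ?scale1r //.
  by move=> j /wz /= /eqP ->; rewrite scale0r.
have wi1 : 0 < 1 - w i by rewrite subr_gt0 lt_neqAle wi /=; lra.
have -> : \sum_(j <- r) w j *: p j = (1 - w i) *: \sum_(j <- r) (w j / (1 - w i)) *: p j.
  rewrite scaler_sumr; apply: eq_bigr => j _.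
  by rewrite scalerA mulrC mulfVK // gt_eqF.
apply: cK => //; last by lra.
apply: IH => [j|]; first by rewrite divr_ge0 // ltW.
by rewrite -mulr_suml ler_pdivrMr // mul1r; lra.
Qed.

Lemma row_sum_coords k (u : 'rV[R]_k) (s : 'I_k -> R) :
  (forall j, s j * u 0 j = `|u 0 j| /\ s j ^+ 2 = 1) ->
  u = \sum_j `|u 0 j| *: (s j *: delta_mx 0 j).
Proof.
move=> hs; rewrite [LHS]row_sum_delta; apply: eq_bigr => j _.
have [<- s1] := hs j.
by rewrite scalerA mulrAC -expr2 s1 mul1r.
Qed.

Lemma simplex_inscribed k (Q : set 'rV[R]_k) : Defs.convex_set Q -> Q 0 ->
  (forall j, Q (delta_mx 0 j)) -> exists c A, inscribed Q c A /\ A \in unitmx.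
Proof.
(* The ball of radius [h] about [(h, ..., h)] has coordinates in [[0, 2h]] with sum at most
   [2hk <= 1]. Using [k.+1] keeps [h] meaningful for [k = 0]. *)
move=> cQ Q0 Qd; pose h : R := (2 * k.+1%:R)^-1.
have h0 : 0 < h by rewrite invr_gt0 mulr_gt0.
exists (const_mx h), h%:M; split; last first.
  by rewrite unitmxE det_scalar unitfE expf_eq0 gt_eqF // andbF.
move=> u u1; rewrite mul_mx_scalar [X in Q X]row_sum_delta.
have uj j : -1 <= u 0 j <= 1.
  have := coord_sqr_le_dot u j => u2; apply/andP; split; nra.
apply: convex_subcomb => // [j|].
  by rewrite !mxE; have := uj j => /andP[]; nra.
apply: (@le_trans _ _ (\sum_(j < k) 2 * h)).
  by apply: ler_sum => j _; rewrite !mxE; have := uj j => /andP[]; nra.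
rewrite sumr_const card_ord -[X in X <= _]mulr_natr /h invfM mulrA mulfV ?pnatr_eq0 // mul1r.
by rewrite mulrC ler_pdivrMr // mul1r ler_nat.
Qed.

Lemma crosspolytope_inscribed k (Q : set 'rV[R]_k) : Defs.convex_set Q ->
  symmetric0 Q -> Q 0 ->
  (forall j, Q (delta_mx 0 j)) -> exists2 A, inscribed Q 0 A & A \in unitmx.
Proof.
move=> cQ sQ Q0 Qd; pose h : R := (k.+1%:R)^-1.
have h0 : 0 < h by rewrite invr_gt0.
exists h%:M; last first.
  by rewrite unitmxE det_scalar unitfE expf_eq0 gt_eqF // andbF.
move=> u u1; rewrite add0r mul_mx_scalar.
have uj j : -1 <= u 0 j <= 1.
  have := coord_sqr_le_dot u j => u2; apply/andP; split; nra.
(* The signs of the coordinates move into the basis vectors, which symmetry keeps in [Q], so the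
   weights become nonnegative with sum at most [k * h <= 1]. *)
rewrite (@row_sum_coords _ (h *: u) (fun j => if 0 <= u 0 j then 1 else -1)); last first.
  move=> j; rewrite mxE normrM (gtr0_norm h0).
  case: lerP => uj0; rewrite ?(ger0_norm uj0) ?(ltr0_norm uj0); split; ring.
apply: convex_subcomb => // [j|].
  by case: ifP => _; rewrite ?scale1r ?scaleN1r //; exact: sQ.
apply: (@le_trans _ _ (\sum_(j < k) h)).
  apply: ler_sum => j _; rewrite mxE normrM (gtr0_norm h0).
  by apply: ler_piMr; [exact: ltW | rewrite ler_norml].
rewrite sumr_const card_ord -[X in X <= _]mulr_natr /h.
by rewrite mulrC ler_pdivrMr // mul1r ler_nat.
Qed.

(** A largest linearly independent family of differences [y - x0] spans the directions of the affine
    hull: a point outside would extend it. *)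
Lemma affine_frame n (K : set 'rV[R]_n) x0 :
  exists k (M : 'M[R]_(k, n)), [/\ row_free M, forall j, K (x0 + row j M) &
    forall y, K y -> (y - x0 <= M)%MS].
Proof.
pose P k := `[< exists M : 'M[R]_(k, n), row_free M /\ forall j, K (x0 + row j M) >].
have P0 : exists k, P k.
  exists 0%N; apply/asboolP; exists 0; split; last by case.
  by rewrite /row_free mxrank0.
have Pn k : P k -> (k <= n)%N.
  by move=> /asboolP[M [/eqP rM _]]; rewrite -rM; exact: rank_leq_col.
have [k /asboolP[M [fM KM]] kmax] := ex_maxnP P0 Pn.
exists k, M; split => // y Ky; apply: contraT => yM.
suff /kmax : P (k + 1)%N by rewrite addn1 ltnn.
apply/asboolP; exists (col_mx M (y - x0)); split; last first.
  move=> j; case: (splitP j) => l jl.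
    have -> : j = lshift 1 l by apply/val_inj.
    by rewrite rowKu.
  have -> : j = rshift k l by apply/val_inj.
  by rewrite rowKd row_id addrC subrK.
have /rank_ltmx : (M < col_mx M (y - x0))%MS.
  by rewrite ltmxE col_mx_sub submx_refl yM andbT -addsmxE addsmxSl.
by rewrite (eqP fM) /row_free eqn_leq rank_leq_row /= {2}addn1.
Qed.

Lemma coord_bounded_preim k n (K : set 'rV[R]_n) x0 (M : 'M[R]_(k, n)) :
  row_free M -> coord_bounded K -> coord_bounded [set z | K (x0 + z *m M)].
Proof.
move=> /row_freeP[M' MM'] [D KD].
exists (\sum_j \sum_l (`|D| + `|x0 0 l|) * `|M' l j|) => z j /= Kz.
have -> : z = (x0 + z *m M - x0) *m M'.
  by rewrite addrAC subrr add0r -mulmxA MM' mulmx1.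
rewrite mxE (le_trans (ler_norm_sum _ _ _)) // (bigD1 j) //=.
apply: ler_wpDr.
  by apply: sumr_ge0 => i _; apply: sumr_ge0 => l _; rewrite mulr_ge0 // addr_ge0.
apply: ler_sum => l _; rewrite normrM ler_wpM2r //.
have -> : (x0 + z *m M - x0) 0 l = (x0 + z *m M) 0 l - x0 0 l by rewrite !mxE.
by rewrite (le_trans (ler_normB _ _)) // lerD2r (le_trans (KD _ _ Kz)) // ler_norm.
Qed.

Lemma frame_delta n k (K : set 'rV[R]_n) x0 (M : 'M[R]_(k, n)) :
  (forall j, K (x0 + row j M)) -> forall j, K (x0 + delta_mx 0 j *m M).
Proof. by move=> KM j; rewrite -rowE. Qed.

(* [E = {c + u T : |u| <= 1}] satisfies [E `<=` K `<=` c + al (E - c)]. *)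
Definition ellipsoid_sandwich k n (K : set 'rV[R]_n) (c : 'rV[R]_n) (T : 'M[R]_(k, n))
    (al : R) :=
  [/\ row_free T, inscribed K c T &
      forall y, K y -> exists2 u, dot u u <= al ^+ 2 & y = c + u *m T].

(** In the coordinates of an affine frame the body contains a full-dimensional simplex, hence an
    ellipsoid to start from, and the dimension [k] of the hull is at most [n]. *)
Lemma john n (K : set 'rV[R]_n) (s : R) : Defs.convex_set K -> coord_bounded K ->
  K !=set0 -> n%:R < s ->
  exists k c (T : 'M[R]_(k, n)), ellipsoid_sandwich K c T s.
Proof.
move=> cK bK [x0 Kx0] ns; have s0 : 0 < s by exact: le_lt_trans ns.
have [k [M [fM KM Ksub]]] := affine_frame K x0.
have kn : (k <= n)%N by rewrite -(eqP fM) rank_leq_col.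
have ks : k%:R < s by rewrite (le_lt_trans _ ns) // ler_nat.
have cQ := @convex_affine_preim _ _ K x0 M cK.
have [|c [A [QA uA hA]]] := john_full cQ (coord_bounded_preim _ fM bK) s0 ks.
  apply: (simplex_inscribed cQ); first by rewrite /= mul0mx addr0.
  exact: frame_delta.
exists k, (x0 + c *m M), (A *m M); split.
- by rewrite /row_free mxrankMfree // (eqP (_ : row_free A)) // row_free_unit.
- by move=> u /QA /=; rewrite mulmxDl addrA mulmxA.
move=> y Ky; have /submxP[z zE] := Ksub y Ky.
have Qz : [set z | K (x0 + z *m M)] z by rewrite /= -zE addrC subrK.
have [u u1 zu] := hA z Qz; exists u => //.
by rewrite mulmxA -addrA -mulmxDl -zu -zE addrC subrK.
Qed.

Lemma john_sym n (K : set 'rV[R]_n) (s : R) : Defs.convex_set K -> symmetric0 K ->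
  coord_bounded K -> K !=set0 -> Num.sqrt n%:R < s ->
  exists k (T : 'M[R]_(k, n)), ellipsoid_sandwich K 0 T s.
Proof.
move=> cK sK bK [x Kx] qs; have s0 : 0 < s by exact: le_lt_trans qs.
have ns : n%:R < s ^+ 2.
  by rewrite -[n%:R]sqr_sqrtr // ltr_pXn2r // nnegrE ?sqrtr_ge0 // ltW.
have K0 : K 0.
  have -> : 0 = 2^-1 *: x + (1 - 2^-1) *: - x.
    by rewrite scalerN -scalerBl (_ : _ - _ = 0) ?scale0r //; lra.
  by apply: cK => //; [exact: sK | lra].
have [k [M [fM KM Ksub]]] := affine_frame K 0.
have kn : (k <= n)%N by rewrite -(eqP fM) rank_leq_col.
have ks : k%:R < s ^+ 2 by rewrite (le_lt_trans _ ns) // ler_nat.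
have cQ := @convex_affine_preim _ _ K 0 M cK.
have sQ : symmetric0 [set z | K (0 + z *m M)].
  by move=> z /=; rewrite !add0r mulNmx; exact: sK.
have [|A [QA uA hA]] := john_full_sym cQ sQ (coord_bounded_preim _ fM bK) s0 ks.
  apply: (crosspolytope_inscribed cQ sQ); first by rewrite /= mul0mx addr0.
  exact: frame_delta.
exists k, (A *m M); split.
- by rewrite /row_free mxrankMfree // (eqP (_ : row_free A)) // row_free_unit.
- by move=> u /QA /=; rewrite !add0r mulmxA.
move=> y Ky; have /submxP[z zE] := Ksub y Ky; rewrite subr0 in zE.
have Qz : [set z | K (0 + z *m M)] z by rewrite /= -zE add0r.
have [u u1 zu] := hA z Qz; exists u => //.
by rewrite add0r mulmxA -zu.
Qed.

End John.

(** * Spectral theory of a symmetric matrix by maximisation on spheres *)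

Section Sphere.
Variable R : realType.

Lemma mulmx_coord_continuous k m (A : 'M[R]_(k, m)) j :
  continuous (fun u : 'rV[R]_k => (u *m A) 0 j).
Proof.
rewrite (_ : (fun _ => _) = fun u : 'rV[R]_k => \sum_l u 0 l * A l j); last first.
  by apply/funext => v; rewrite mxE.
apply: continuous_big => [|l _ u]; first exact: add_continuous.
apply: continuousM; last exact: cst_continuous.
exact: coord_continuous.
Qed.

Lemma quadratic_continuous k (G : 'M[R]_k) :
  continuous (fun u : 'rV[R]_k => dot (u *m G) u).
Proof.
rewrite (_ : (fun _ => _) = fun u : 'rV[R]_k => \sum_l (u *m G) 0 l * u 0 l); last first.
  by apply/funext => v; rewrite dotE.
apply: continuous_big => [|l _ u]; first exact: add_continuous.
apply: continuousM; first exact: mulmx_coord_continuous.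
exact: coord_continuous.
Qed.

Lemma dot_continuous k : continuous (fun u : 'rV[R]_k => dot u u).
Proof.
rewrite (_ : (fun _ => _) = fun u : 'rV[R]_k => dot (u *m 1%:M) u).
  exact: quadratic_continuous.
by apply/funext => u; rewrite mulmx1.
Qed.

Lemma subsphere_compact k m (A : 'M[R]_(k, m)) :
  compact [set u : 'rV[R]_k | dot u u = 1 /\ u *m A = 0].
Proof.
apply: bounded_closed_compact.
  exists 1; split => // r r1 u [u1 _] /=.
  rewrite /Num.norm /= mx_normrE; apply/bigmax_leP; split; first by lra.
  move=> [i j] _ /=; rewrite ord1.
  have := coord_sqr_le_dot u j; rewrite u1 => h.
  by rewrite (le_trans _ (ltW r1)) // ler_norml; apply/andP; split; nra.
rewrite (_ : [set u | _] = (fun u : 'rV[R]_k => dot u u) @^-1` [set 1] `&`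
  \bigcap_(j in [set: 'I_m]) ((fun u : 'rV[R]_k => (u *m A) 0 j) @^-1` [set 0])).
  apply: closedI.
    apply: preimage_closed; last exact: closed_eq.
    by move=> u _; exact: dot_continuous.
  apply: closed_bigI => j _.
  apply: preimage_closed; last exact: closed_eq.
  by move=> u _; exact: mulmx_coord_continuous.
apply/seteqP; split => u /= [u1 uA]; split => //.
  by move=> j _ /=; rewrite uA mxE.
by apply/rowP => j; rewrite [RHS]mxE; exact: (uA j I).
Qed.

Lemma exists_orthogonal_unit k j (U : 'M[R]_(j, k)) : (j < k)%N ->
  exists2 w : 'rV[R]_k, dot w w = 1 & w *m U^T = 0.
Proof.
move=> jk.
have kn0 : kermx U^T != 0.
  rewrite -mxrank_eq0 mxrank_ker -lt0n subn_gt0 mxrank_tr.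
  by rewrite (leq_ltn_trans (rank_leq_row _)).
have v0 : nz_row (kermx U^T) != 0 by rewrite nz_row_eq0.
exists ((Num.sqrt (dot (nz_row (kermx U^T)) (nz_row (kermx U^T))))^-1 *: nz_row (kermx U^T)).
  exact: normalize.
by rewrite -scalemxAl (sub_kermxP (nz_row_sub _)) scaler0.
Qed.

(** The Rayleigh quotient attains its maximum on the compact unit sphere of the complement of the
    rows of [U]; homogeneity extends the bound to all vectors there. *)
Lemma quadratic_max k j (G : 'M[R]_k) (U : 'M[R]_(j, k)) : (j < k)%N ->
  exists2 w : 'rV[R]_k, dot w w = 1 /\ w *m U^T = 0 &
    forall v, v *m U^T = 0 -> dot (v *m G) v <= dot (w *m G) w * dot v v.
Proof.
move=> jk; have [w0 w01 w0U] := exists_orthogonal_unit U jk.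
have [||w] := @EVT_max_rV R k (fun u => dot (u *m G) u) _ _ (@subsphere_compact k j U^T).
- by exists w0.
- by apply: continuous_subspaceT; exact: quadratic_continuous.
rewrite inE => -[w1 wU] maxw; exists w => // v vU.
have [->|v0] := eqVneq v 0.
  by rewrite mul0mx !dot0l mulr0.
have := maxw ((Num.sqrt (dot v v))^-1 *: v).
rewrite inE => /(_ (conj (normalize v0) _)) /=.
rewrite -!scalemxAl vU scaler0 => /(_ erefl).
rewrite dotZl dotZr mulrA -expr2 exprVn sqr_sqrtr ?dot_ge0 // mulrC.
by rewrite ler_pdivrMr // dot_gt0.
Qed.

(* Vanishing of the first variation at a constrained maximum. *)
Lemma quadratic_max_stationary k (G : 'M[R]_k) (w v : 'rV[R]_k) (mu : R) :
  G^T = G -> dot w w = 1 -> dot (w *m G) w = mu ->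
  (forall t, dot ((w + t *: v) *m G) (w + t *: v) <= mu * dot (w + t *: v) (w + t *: v)) ->
  dot (v *m G) v <= mu * dot v v ->
  dot (v *m G) w = mu * dot v w.
Proof.
move=> GT w1 wmu hmax vmu.
pose al := mu * dot v w - dot (v *m G) w; pose be := mu * dot v v - dot (v *m G) v.
have be0 : 0 <= be by rewrite subr_ge0.
have be1 : 0 < be + 1 by lra.
have wv : dot (w *m G) v = dot (v *m G) w by rewrite dot_mulmxl GT dotC.
have key t : 0 <= 2 * t * al + t ^+ 2 * be.
  have := hmax t; rewrite mulmxDl -scalemxAl !dot_lin wmu w1 wv (dotC w v).
  rewrite -subr_ge0 /al /be; set X := (X in 0 <= X -> _).
  by move=> X0; apply: le_trans X0 _; rewrite /X le_eqVlt; apply/orP; left; apply/eqP; ring.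
(* A near-minimiser of the quadratic in [t]; the [+ 1] covers [be = 0]. Its value is negative unless
   [al = 0]. *)
have := key (- al / (be + 1)).
have -> : 2 * (- al / (be + 1)) * al + (- al / (be + 1)) ^+ 2 * be =
  - (al ^+ 2 * (be + 2) / (be + 1) ^+ 2) by field; rewrite gt_eqF.
rewrite oppr_ge0 pmulr_lle0 ?invr_gt0 ?exprn_gt0 // pmulr_lle0; last by lra.
move=> al2; have : al ^+ 2 == 0 by rewrite eq_le al2 sqr_ge0.
by rewrite sqrf_eq0 subr_eq0 => /eqP.
Qed.

(** The rows of [U] stand for the leading eigenvectors. Invariance is recorded for the orthogonal
    complement, which is what makes cross terms vanish when a new vector is added. *)
Definition spectral_head k j (G : 'M[R]_k) (U : 'M[R]_(j, k)) (mu : R) :=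
  [/\ U *m U^T = 1%:M, forall v : 'rV[R]_k, v *m U^T = 0 -> v *m G *m U^T = 0 &
      forall c, mu * dot c c <= dot (c *m U *m G) (c *m U)].

(** Stationarity of [w] makes [v *m G] orthogonal to [w] whenever [v] is orthogonal to [w] and [U],
    so the smaller complement is again invariant and the form splits over [w] and [U]. *)
Lemma spectral_head_extend k j (G : 'M[R]_k) (U : 'M[R]_(j, k)) (w : 'rV[R]_k) :
  G^T = G -> dot w w = 1 -> w *m U^T = 0 ->
  (forall v, v *m U^T = 0 -> dot (v *m G) v <= dot (w *m G) w * dot v v) ->
  spectral_head G U (dot (w *m G) w) ->
  spectral_head G (col_mx w U) (dot (w *m G) w).
Proof.
move=> GT w1 wU maxw [UU stab low]; split.
- rewrite tr_col_mx mul_col_row UU wU dot_mulmxE w1.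
  have -> : U *m w^T = 0 by rewrite -[U]trmxK -trmx_mul wU trmx0.
  by rewrite -scalar_mx_block.
- move=> v; rewrite tr_col_mx mul_mx_row => /eqP; rewrite row_mx_eq0.
  move=> /andP[/eqP vw /eqP vU]; rewrite mul_mx_row stab // dot_mulmxE.
  have vw0 : dot v w = 0 by rewrite /dot vw mxE.
  rewrite (@quadratic_max_stationary _ G w v (dot (w *m G) w)) //; last exact: maxw.
    by rewrite vw0 mulr0 raddf0 row_mx0.
  by move=> t; apply: maxw; rewrite mulmxDl -scalemxAl wU vU scaler0 addr0.
move=> c; rewrite -[c]hsubmxK; set c1 := lsubmx _; set c2 := rsubmx _.
rewrite [c1]mx11_scalar; set t := c1 0 0.
rewrite mul_row_col mul_scalar_mx.
have -> : dot (row_mx t%:M c2) (row_mx t%:M c2) = t ^+ 2 + dot c2 c2.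
  by rewrite /dot tr_row_mx mul_row_col mxE tr_scalar_mx -scalar_mxM mxE eqxx.
have cw : dot (c2 *m U *m G) w = 0.
  by rewrite dot_mulmxl GT dot_mulmxl stab // dot0r.
have wc : dot (w *m G) (c2 *m U) = 0 by rewrite dot_mulmxl GT dotC.
rewrite mulmxDl -scalemxAl !dot_lin cw wc.
by have := low c2; lra.
Qed.

Lemma spectral_head_exists k (G : 'M[R]_k) j : G^T = G -> (j < k)%N ->
  exists (U : 'M[R]_(j, k)) (w : 'rV[R]_k),
   [/\ dot w w = 1, w *m U^T = 0, spectral_head G U (dot (w *m G) w) &
       forall v, v *m U^T = 0 -> dot (v *m G) v <= dot (w *m G) w * dot v v].
Proof.
move=> GT; elim: j => [|j IH] jk.
  have [w [w1 wU] maxw] := quadratic_max G (0 : 'M[R]_(0, k)) jk.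
  exists 0, w; split => //; split.
  - by apply/matrixP => -[].
  - by move=> v _; apply/matrixP => ? [].
  by move=> c; rewrite mulmx0 mul0mx dot0l (dotE c) big_ord0 mulr0.
have [U [w [w1 wU hU maxw]]] := IH (ltnW jk).
have [w' [w'1 w'U] maxw'] := quadratic_max G (col_mx w U : 'M[R]_(j.+1, k)) jk.
exists (col_mx w U), w'; split => //.
have [VV stab low] := spectral_head_extend GT w1 wU maxw hU.
(* [w'] was a competitor in the maximisation that gave [w], so the new value is no larger than the
   old. *)
split => // c; apply: le_trans (low c); apply: ler_wpM2r; first exact: dot_ge0.
have w'U0 : w' *m U^T = 0.
  have : w' *m (col_mx w U)^T = 0 := w'U.
  by rewrite tr_col_mx mul_mx_row => /eqP; rewrite row_mx_eq0 => /andP[_ /eqP].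
by have := maxw _ w'U0; rewrite w'1 mulr1.
Qed.

(** Both halves of the Courant-Fischer principle for the eigenvalue [mu] of index [j.+1] in
    decreasing order. *)
Lemma spectral_split k (G : 'M[R]_k) j : G^T = G -> (j < k)%N ->
  exists (U : 'M[R]_(j, k)) (V : 'M[R]_(j.+1, k)) (mu : R),
   [/\ U *m U^T = 1%:M, V *m V^T = 1%:M,
       exists2 w, dot w w = 1 & dot (w *m G) w = mu,
       forall c, mu * dot c c <= dot (c *m V *m G) (c *m V) &
       forall v, v *m U^T = 0 -> dot (v *m G) v <= mu * dot v v].
Proof.
move=> GT jk; have [U [w [w1 wU hU maxw]]] := spectral_head_exists GT jk.
have [VV _ low] := spectral_head_extend GT w1 wU maxw hU.
exists U, (col_mx w U), (dot (w *m G) w); split => //; first by case: hU.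
by exists w.
Qed.

End Sphere.

(** * Norms on row vectors: continuity and boundedness of the unit ball *)

Section Norms.
Variables (R : realType) (n : nat).

Lemma coord_le_mx_norm (x : 'rV[R]_n) j : `|x 0 j| <= `|x|.
Proof.
by rewrite [leRHS]/Num.norm /= mx_normrE; apply/bigmax_geP; right => /=; exists (0, j).
Qed.

Lemma compact_coord_bounded (K : set 'rV[R]_n) : compact K -> coord_bounded K.
Proof.
move=> /compact_bounded[M [_ MK]]; exists (M + 1) => y j Ky.
by apply: le_trans (coord_le_mx_norm y j) _; apply: MK Ky; lra.
Qed.

Variable N : 'rV[R]_n -> R.
Hypothesis normN : is_norm N.

Lemma is_norm_ge0 x : 0 <= N x. Proof. by case: normN. Qed.
Lemma is_normZ a x : N (a *: x) = `|a| * N x. Proof. by case: normN. Qed.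
Lemma is_normD x y : N (x + y) <= N x + N y. Proof. by case: normN. Qed.
Lemma is_norm0 : N 0 = 0.
Proof. by rewrite -(scale0r 0) is_normZ normr0 mul0r. Qed.
Lemma is_norm_gt0 x : x != 0 -> 0 < N x.
Proof.
move=> x0; rewrite lt_def is_norm_ge0 andbT; apply: contra x0 => /eqP.
by case: normN => _ h _ _ /h ->.
Qed.

Lemma is_norm_le_mx_norm x : N x <= (\sum_j N (delta_mx 0 j)) * `|x|.
Proof.
rewrite {1}[x]row_sum_delta mulr_suml.
apply: (@le_trans _ _ (\sum_j N (x 0 j *: delta_mx 0 j))).
  elim/big_rec2: _ => [|j y z _ le]; first by rewrite is_norm0.
  by apply: le_trans (is_normD _ _) _; rewrite lerD2l.
apply: ler_sum => j _; rewrite is_normZ mulrC ler_wpM2l ?is_norm_ge0 //.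
exact: coord_le_mx_norm.
Qed.

Lemma is_norm_continuous : continuous N.
Proof.
move=> x; apply/(@cvgrPdist_le R R _ (nbhs x) _ N (N x)) => e e0.
pose C := \sum_j N (delta_mx 0 j).
have C0 : 0 <= C by apply: sumr_ge0 => j _; exact: is_norm_ge0.
have : \forall y \near x, ball x (e / (C + 1)) y.
  by apply: nbhsx_ballx; rewrite divr_gt0 //; lra.
apply: filterS => y; rewrite -ball_normE /= => xy.
have dist u v : N u - N v <= N (u - v).
  by rewrite lerBlDr; have := is_normD (u - v) v; rewrite subrK.
have yx : N (y - x) = N (x - y).
  by rewrite -opprB -scaleN1r is_normZ normrN1 mul1r.
apply: (@le_trans _ _ (N (x - y))).
  by rewrite ler_norml dist andbT lerNl opprB -yx dist.
apply: le_trans (is_norm_le_mx_norm _) _; rewrite -/C.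
apply: (@le_trans _ _ (C * (e / (C + 1)))); first by rewrite ler_wpM2l // ltW.
by rewrite mulrA ler_pdivrMr; nra.
Qed.

(** A norm has a positive minimum on the Euclidean unit sphere, and its inverse bounds the Euclidean
    length over the unit ball. For [n = 0] the sphere is empty. *)
Lemma unit_ball_coord_bounded : coord_bounded (unit_ball N).
Proof.
have [n0|n0] := posnP n.
  by exists 0 => y j; have := ltn_ord j; rewrite [X in (_ < X)%N -> _]n0.
have [w w1 _] := exists_orthogonal_unit (0 : 'M[R]_(0, n)) n0.
(* The zero matrix imposes no constraint, so the minimum is over the whole sphere. *)
have [||z] := @EVT_min_rV R n N _ _ (@subsphere_compact R n 1 0).
- by exists w; split => //; rewrite mulmx0.
- by apply: continuous_subspaceT; exact: is_norm_continuous.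
rewrite inE => -[z1 _] minz.
have z0 : 0 < N z.
  apply: is_norm_gt0; apply/eqP => z0; move: z1; rewrite z0 dot0l => /eqP.
  by rewrite eq_sym oner_eq0.
exists (N z)^-1 => y j /= Ny.
have [->|y0] := eqVneq y 0; first by rewrite mxE normr0 invr_ge0 ltW.
pose r := Num.sqrt (dot y y).
have r0 : 0 < r by rewrite sqrtr_gt0 dot_gt0.
have yr : `|y 0 j| <= r.
  rewrite -(ler_pXn2r (isT : (0 < 2)%N)) ?nnegrE ?(ltW r0) // real_normK ?num_real //.
  by rewrite sqr_sqrtr ?dot_ge0 // coord_sqr_le_dot.
apply: (le_trans yr).
have := minz (r^-1 *: y).
rewrite inE => /(_ (conj (normalize y0) (mulmx0 _ _))).
rewrite is_normZ gtr0_norm ?invr_gt0 // mulrC ler_pdivlMr // => h.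
by rewrite -[_^-1]mul1r ler_pdivlMr // mulrC (le_trans h).
Qed.

Lemma unit_ball_convex : Defs.convex_set (unit_ball N).
Proof.
move=> x y t; rewrite /unit_ball /= => Nx Ny t0 t1.
apply: le_trans (is_normD _ _) _; rewrite !is_normZ !ger0_norm ?subr_ge0 //.
have := ler_wpM2l t0 Nx; have := @ler_wpM2l _ (1 - t) _ _ _ Ny.
by rewrite subr_ge0 => /(_ t1); lra.
Qed.

Lemma unit_ball_sym : symmetric0 (unit_ball N).
Proof. by move=> x; rewrite /unit_ball /= -scaleN1r is_normZ normrN1 mul1r. Qed.

Lemma unit_ball0 : unit_ball N 0.
Proof. by rewrite /unit_ball /= is_norm0. Qed.

Lemma unit_ball_absorb x : exists2 r : R, 0 < r & unit_ball N (r *: x).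
Proof.
have [->|x0] := eqVneq x 0; first by exists 1 => //; rewrite scaler0; exact: unit_ball0.
have Nx := is_norm_gt0 x0.
exists (N x)^-1; rewrite ?invr_gt0 // /unit_ball /= is_normZ.
by rewrite gtr0_norm ?invr_gt0 // mulVf // gt_eqF.
Qed.

End Norms.

(** * Comparing the two radii through the semi-axes of the ellipsoids *)

Section Ratio.
Variable R : realType.

Lemma inr_witness n (N : 'rV[R]_n -> R) (K : set 'rV[R]_n) i :
  0 < inr i K (unit_ball N) ->
  exists rho (L : 'M[R]_n) x, [/\ 0 < rho, \rank L = i &
    forall b, unit_ball N b -> (b <= L)%MS -> K (x + rho *: b)].
Proof.
rewrite /inr; set E := [set rho | _] => r0.
(* [sup] is 0 by default on a set without supremum, so positivity of the radius excludes that
   case. *)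
have hE : has_sup E by apply: contrapT => /sup_out e; move: r0; rewrite e ltxx.
have [rho [_ [L [x [rL KL]]]]] := sup_adherent r0 hE; rewrite subrr => rho0.
by exists rho, L, x.
Qed.

Lemma dot_orthonormal k j (U : 'M[R]_(j, k)) c : U *m U^T = 1%:M ->
  dot (c *m U) (c *m U) = dot c c.
Proof. by move=> UU; rewrite dot_mulmxl -mulmxA UU mulmx1. Qed.

Lemma orthonormal_row_free k j (U : 'M[R]_(j, k)) : U *m U^T = 1%:M -> row_free U.
Proof. by move=> UU; apply/row_freeP; exists U^T. Qed.

Lemma rank_gen_mulfree k n j (U : 'M[R]_(j, k)) (T : 'M[R]_(k, n)) :
  U *m U^T = 1%:M -> row_free T -> \rank <<U *m T>>%MS = j.
Proof.
by move=> /orthonormal_row_free /eqP fU fT; rewrite genmxE mxrankMfree.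
Qed.

Lemma radii_ratio_le n (N : 'rV[R]_n -> R) (K : set 'rV[R]_n) i k m c
    (T : 'M[R]_(k, n)) (S : 'M[R]_(m, n)) (al be : R) :
  is_norm N -> (1 <= i <= n)%N -> 0 < inr i K (unit_ball N) ->
  0 < al -> 0 < be ->
  ellipsoid_sandwich K c T al -> ellipsoid_sandwich (unit_ball N) 0 S be ->
  circumR (n - i + 1) K (unit_ball N) / inr i K (unit_ball N) <= al * be.
Proof.
move=> nN; case: i => [//|j] /= jn r0 al0 be0 [fT KT TK] [fS BS SB].
have inS (x : 'rV[R]_n) : (x <= S)%MS.
  have [r rp /SB[v _]] := unit_ball_absorb nN x; rewrite add0r => rx.
  rewrite -(scale1r x) -(mulVf (lt0r_neq0 rp)) -scalerA rx scalemx_sub //.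
  exact: submxMl.
(* A positive inner radius puts a piece of an [i]-dimensional subspace into [K], so the hull of [K],
   of dimension [k], has dimension at least [i = j.+1]. *)
have jk : (j < k)%N.
  have [rho [L [x [rho0 rL KL]]]] := inr_witness r0.
  suff : (L <= T)%MS by move=> /mxrankS; rewrite rL (eqP fT).
  apply/row_subP => l.
  have [r rp Br] := unit_ball_absorb nN (row l L).
  have /TK[u1 _ E1] := KL _ Br (scalemx_sub _ (row_sub _ _)).
  have /TK[u2 _ E2] := KL _ (unit_ball0 nN) (sub0mx _ _).
  have E : rho *: (r *: row l L) = (u1 - u2) *m T.
    move: E1 E2; rewrite scaler0 addr0 => + xE; rewrite xE -addrA => /addrI.
    by rewrite mulmxBl => <-; rewrite addrAC subrr add0r.
  have rr : rho * r != 0 by rewrite mulf_neq0 // gt_eqF.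
  rewrite -(scale1r (row l L)) -(mulVf rr) -!scalerA E scalemx_sub //.
  exact: submxMl.
(* In coordinates where [F] is the unit ball, [E] is a translate of the image of the ball under [P],
   and the eigenvalues of [P *m P^T] are the squared semi-axes of [E]. *)
pose P := T *m pinvmx S.
have PS : P *m S = T by apply: mulmxKpV; apply/row_subP => l.
have dotP v : dot (v *m (P *m P^T)) v = dot (v *m P) (v *m P).
  by rewrite mulmxA dot_mulmxl trmxK.
have GT : (P *m P^T)^T = P *m P^T by rewrite trmx_mul trmxK.
have [U [V [mu [UU VV [w w1 wmu] low upp]]]] := spectral_split GT jk.
have mu0 : 0 < mu.
  rewrite -wmu dotP dot_gt0; apply/eqP => wP.
  have wT : w *m T = 0 *m T by rewrite mul0mx -PS mulmxA wP mul0mx.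
  by move: w1; rewrite (row_free_inj fT wT) dot0l => /eqP; rewrite eq_sym oner_eq0.
pose a := Num.sqrt mu.
have a0 : 0 < a by rewrite sqrtr_gt0.
have aE : a ^+ 2 = mu by rewrite sqr_sqrtr // ltW.
(* Since [B] lies in [be F], scaling [B :&: V] by [a / be] lands in [a (F :&: V)], hence in [E]
   after translation. *)
have lower : a / be <= inr j.+1 K (unit_ball N).
  rewrite /inr; set E := [set rho | _].
  have hE : has_sup E.
    by apply: contrapT => /sup_out e; move: r0; rewrite /inr -/E e ltxx.
  apply: (sup_upper_bound hE); split; first by rewrite divr_ge0 ?ltW.
  exists <<V *m T>>%MS, c; split; first exact: rank_gen_mulfree.
  move=> b /SB[v vb]; rewrite add0r genmxE => bv /submxP[d bd].
  have vE : v = d *m V *m P.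
    by apply: (row_free_inj fS); rewrite /= -bv bd -(mulmxA _ P) PS mulmxA.
  have -> : (a / be) *: b = ((a / be) *: (d *m V)) *m T.
    by rewrite bd -scalemxAl mulmxA.
  apply: KT; rewrite dotZl dotZr mulrA -expr2 exprMn aE exprVn dot_orthonormal //.
  rewrite mulrAC ler_pdivrMr ?exprn_gt0 // mul1r (le_trans (low d)) //.
  by rewrite dotP -vE.
have upper : circumR (n - j.+1 + 1) K (unit_ball N) <= al * a.
  apply: ge_inf; first by exists 0 => rho [].
  split; first by rewrite mulr_ge0 ?ltW.
  exists <<U *m T>>%MS, c; split.
    (* The index [n - i + 1] equals [n - j], so the subspace in [circumR] must have dimension
       exactly [j], the number of rows of [U]. *)
    by rewrite rank_gen_mulfree // addn1 subnSK // subKn // ltnW.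
  move=> y /TK[u ual ->].
  (* The component along [U] is absorbed by the subspace; the rest [v] is no longer than [u], and
     [upp] bounds its image by [al * a] in the coordinates of [F]. *)
  pose d := u *m U^T; pose v := u - d *m U.
  have vU : v *m U^T = 0 by rewrite mulmxBl -mulmxA UU mulmx1 subrr.
  have uE : u = v + d *m U by rewrite subrK.
  move: d v vU uE => d v vU uE.
  have v2 : dot v v <= al ^+ 2.
    apply: le_trans ual.
    have dU : dot (d *m U) (d *m U) = dot d d by exact: dot_orthonormal.
    have vd : dot v (d *m U) = 0 by rewrite dotC dot_mulmxl vU dot0r.
    rewrite uE !dot_lin vd (dotC (d *m U)) vd dU.
    by have := dot_ge0 d; lra.
  exists ((al * a)^-1 *: (v *m T)), (d *m U *m T); split; last split.
  - have := BS ((al * a)^-1 *: (v *m P)).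
    rewrite add0r -scalemxAl -mulmxA PS; apply.
    rewrite dotZl dotZr mulrA -expr2 exprVn mulrC ler_pdivrMr ?exprn_gt0 ?mulr_gt0 //.
    rewrite mul1r exprMn aE -dotP (le_trans (upp _ vU)) // mulrC.
    by rewrite ler_wpM2r // ltW.
  - by rewrite genmxE -mulmxA submxMl.
  rewrite scalerA mulfV ?gt_eqF ?mulr_gt0 // scale1r -addrA -mulmxDl.
  by rewrite -uE.
rewrite ler_pdivrMr // (le_trans upper) //.
have -> : al * a = al * be * (a / be) by rewrite mulrACA mulfV ?gt_eqF // mulr1.
by rewrite ler_wpM2l // mulr_ge0 ?ltW.
Qed.

Lemma le_mul_limit (x p be : R) : 0 < be ->
  (forall al, p < al -> x <= al * be) -> x <= p * be.
Proof.
move=> be0 h; rewrite -ler_pdivrMr //; apply/ler_addgt0Pr => e e0.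
by rewrite ler_pdivrMr // h // ltrDl.
Qed.

End Ratio.

(** * The three bounds, from the John ratios of the body and the ball *)

Lemma eucl_sandwich (R : realType) n : ellipsoid_sandwich (@eucl_ball R n) 0 1%:M 1.
Proof.
have eE (y : 'rV[R]_n) : eucl_ball y <-> dot y y <= 1.
  rewrite /eucl_ball /= dotE; under eq_bigr do rewrite expr2.
  by split.
split; first by rewrite row_free_unit unitmx1.
- by move=> u u1; rewrite add0r mulmx1; apply/eE.
by move=> y /eE y1; exists y; rewrite ?expr1n // add0r mulmx1.
Qed.

Theorem theorem5p2 (R : realType) (n : nat) (N : 'rV[R]_n -> R)
  (K : set 'rV[R]_n) (i : nat) :
  is_norm N -> convex_body K -> (1 <= i <= n)%N ->
  0 < inr i K (unit_ball N) ->
  let ratio := circumR (n - i + 1) K (unit_ball N) / inr i K (unit_ball N) in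
  [/\ ratio <= n%:R * Num.sqrt n%:R,
      (unit_ball N = @eucl_ball R n \/ symmetric0 K) -> ratio <= n%:R
    & (unit_ball N = @eucl_ball R n /\ symmetric0 K) -> ratio <= Num.sqrt n%:R].
Proof.
move=> nN [cptK cK] iN r0 ratio.
have bK := compact_coord_bounded cptK.
have K0 : K !=set0.
  have [rho [L [x [_ _ KL]]]] := inr_witness r0.
  by exists (x + rho *: 0); apply: KL; [exact: unit_ball0 | exact: sub0mx].
have n0 : 0 < n%:R :> R by rewrite ltr0n; case/andP: iN => /leq_trans; apply.
have q0 : 0 < Num.sqrt n%:R :> R by rewrite sqrtr_gt0.
have ratio_le k c (T : 'M[R]_(k, n)) m (S : 'M[R]_(m, n)) al be :
    0 < al -> 0 < be -> ellipsoid_sandwich K c T al ->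
    ellipsoid_sandwich (unit_ball N) 0 S be -> ratio <= al * be.
  exact: (radii_ratio_le nN iN r0).
have B_john be : Num.sqrt n%:R < be ->
    exists m (S : 'M[R]_(m, n)), ellipsoid_sandwich (unit_ball N) 0 S be.
  apply: john_sym; [exact: unit_ball_convex | exact: unit_ball_sym
    | exact: unit_ball_coord_bounded | by exists 0; exact: unit_ball0].
have limit2 p : 0 < p ->
    (forall al, p < al -> exists k c (T : 'M[R]_(k, n)), ellipsoid_sandwich K c T al) ->
    ratio <= p * Num.sqrt n%:R.
  (* John's ratios are available only strictly above [p] and [sqrt n], so both factors are passed to
     the limit in turn. *)
  move=> p0 KT; rewrite mulrC; apply: le_mul_limit => // be qbe.
  rewrite mulrC; apply: le_mul_limit => [|al pal]; first exact: lt_trans qbe.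
  have [k [c [T hT]]] := KT _ pal; have [m [S hS]] := B_john _ qbe.
  by apply: ratio_le hT hS; [exact: lt_trans pal | exact: lt_trans qbe].
have limit1 p : 0 < p -> unit_ball N = @eucl_ball R n ->
    (forall al, p < al -> exists k c (T : 'M[R]_(k, n)), ellipsoid_sandwich K c T al) ->
    ratio <= p.
  (* A Euclidean [B] is its own ellipsoid with ratio exactly 1, leaving a single limit. *)
  move=> p0 BE KT; rewrite -[p]mulr1; apply: le_mul_limit => // al pal.
  have [k [c [T hT]]] := KT _ pal.
  apply: ratio_le hT _; [exact: lt_trans pal | exact: ltr01 | ].
  by rewrite BE; exact: eucl_sandwich.
have K_john al : n%:R < al ->
    exists k c (T : 'M[R]_(k, n)), ellipsoid_sandwich K c T al.
  exact: john.
have K_sym al : symmetric0 K -> Num.sqrt n%:R < al ->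
    exists k c (T : 'M[R]_(k, n)), ellipsoid_sandwich K c T al.
  move=> sK nal; have [k [T hT]] := john_sym cK sK bK K0 nal.
  by exists k, 0, T.
split; first exact: limit2.
- move=> [BE | sK]; first exact: limit1.
  (* For symmetric [K] both ratios are [sqrt n], whose product is [n]. *)
  rewrite -[n%:R]sqr_sqrtr ?ler0n // expr2; apply: limit2 => // al.
  exact: K_sym.
by move=> [BE sK]; apply: limit1 => // al; exact: K_sym.
Qed.
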